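(* Let $G_0$ and $H_0$ be finite graphs with $\zeta_s(G_0)=\chi(G_0)$ and $\zeta_s(H_0)=\chi(H_0)$, where $\zeta_s$ is the strong altermatic number and $\chi$ the chromatic number. Let $k,l\geq 0$ be integers, let $G=M^k(G_0)$ be the graph obtained from $G_0$ by applying the Mycielski construction $k$ times, and let $H=M^l(H_0)$ be the graph obtained from $H_0$ by applying it $l$ times. Then $$\chi(G\times H)=\min\{\chi(G),\chi(H)\},$$ where $G\times H$ is the categorical product.
   Context: Graphs are finite, simple, undirected, with nonempty vertex set. A hypergraph $\mathcal{H}=(V(\mathcal{H}),E(\mathcal{H}))$ consists of a nonempty finite vertex set $V(\mathcal{H})$ and a set $E(\mathcal{H})$ of distinct nonempty subsets of $V(\mathcal{H})$ (isolated vertices and singleton edges are allowed). The general Kneser graph ${\rm KG}(\mathcal{H})$ has vertex set $E(\mathcal{H})$, two vertices being adjacent iff the corresponding edges are disjoint. A homomorphism $G\to H$ of graphs is an adjacency-preserving map $V(G)\to V(H)$. Write $G\longleftrightarrow H$ (homomorphically equivalent) if there are homomorphisms $G\to H$ and $H\to G$. For $X=(x_1,\dots,x_n)\in\{-1,0,+1\}^n$, the alternation number $alt(X)$ is the length of a longest subsequence of nonzero entries of $X$ in which any two consecutive terms have opposite signs; $alt((0,\dots,0))=0$. For a set $V$ of size $n$ let $L_V$ be the set of linear orderings of $V$; for $\sigma\in L_V$ let $\sigma(j)$ be the $j$-th element of $V$ in the ordering $\sigma$, and put $X^+_\sigma=\{\sigma(j): x_j=+1\}$ and $X^-_\sigma=\{\sigma(j):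 x_j=-1\}$. For a hypergraph $\mathcal{H}$ with $n=|V(\mathcal{H})|$ and $\sigma\in L_{V(\mathcal{H})}$: $salt_\sigma(\mathcal{H})$ is the largest integer $k$ such that there is $X\in\{-1,0,+1\}^n$ with $alt(X)=k$ such that at most one of $X^+_\sigma$ and $X^-_\sigma$ contains (as a subset) an edge of $\mathcal{H}$. Set $salt(\mathcal{H})=\min_{\sigma\in L_{V(\mathcal{H})}} salt_\sigma(\mathcal{H})$. The strong altermatic number of a graph $G$ is $$\zeta_s(G)=\max_{\mathcal{H}}\{|V(\mathcal{H})|+1-salt(\mathcal{H}): {\rm KG}(\mathcal{H})\longleftrightarrow G\},$$ the maximum being over all hypergraphs $\mathcal{H}$ with ${\rm KG}(\mathcal{H})\longleftrightarrow G$. (The maximum exists: it is a known theorem that it is bounded above by the chromatic number $\chi(G)$.) For a graph $G$ with vertex set $\{u_1,\dots,u_n\}$, the Mycielskian $M(G)$ is the graph with vertex set $\{u_1,\dots,u_n,v_1,\dots,v_n,w\}$ and edge set $E(G)\cup\{u_iv_j: u_iu_j\in E(G)\}\cup\{wv_i:1\leq i\leq n\}$; $M^0(G)=G$ and $M^{k+1}(G)=M(M^k(G))$. The categorical product $G\times H$ has vertex set $V(G)\times V(H)$, with $(u_1,u_2)$ and $(v_1,v_2)$ adjacent iff $u_1v_1\in E(G)$ and $u_2v_2\in E(H)$. *)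

(* Defs.v *)
From mathcomp Require Import all_boot.

Set Implicit Arguments.
Unset Strict Implicit.
Unset Printing Implicit Defensive.

(* The vertex set may be empty here, because the Kneser graph of a hypergraph
   without edges has no vertices; nonemptiness is assumed where it is needed. *)
Record sgraph := SGraph {
  vertex :> finType;
  adj : rel vertex;
  adj_sym : symmetric adj;
  adj_irr : irreflexive adj }.

Definition hom (G H : sgraph) : Prop :=
  exists f : G -> H, forall x y : G, adj x y -> adj (f x) (f y).

Definition hom_equiv (G H : sgraph) : Prop := hom G H /\ hom H G.

Definition colorable (G : sgraph) (k : nat) : bool :=
  [exists f : {ffun G -> 'I_k},
    [forall x, forall y, adj x y ==> (f x != f y)]].

Lemma colorable_ex (G : sgraph) : exists k, colorable G k.
Proof.
exists #|{: G}|; apply/existsP; exists [ffun x => enum_rank x].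
apply/forallP => x; apply/forallP => y; apply/implyP => xy.
rewrite !ffunE (inj_eq enum_rank_inj).
by apply: contraTneq xy => ->; rewrite adj_irr.
Qed.

Definition chromatic_number (G : sgraph) : nat := ex_minn (colorable_ex G).

Record hypergraph := Hypergraph {
  hvertex : finType;
  hedges : {set {set hvertex}};
  hvertex_gt0 : 0 < #|{: hvertex}|;
  hedges_neq0 : set0 \notin hedges }.

Section Kneser.
Variable H : hypergraph.

Definition kneser_vertex : finType := {e : {set hvertex H} | e \in hedges H}.

Definition kneser_adj : rel kneser_vertex :=
  fun a b => [disjoint val a & val b].

Lemma kneser_sym : symmetric kneser_adj.
Proof. by move=> a b; rewrite /kneser_adj disjoint_sym. Qed.

Lemma kneser_irr : irreflexive kneser_adj.
Proof.
move=> a; rewrite /kneser_adj -setI_eq0 setIid; apply/negbTE.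
by apply: contraNneq (hedges_neq0 H) => <-; exact: (valP a).
Qed.

Definition kneser : sgraph := SGraph kneser_sym kneser_irr.

End Kneser.

(* Sign vectors: Some true is +1, Some false is -1 and None is 0. *)
Definition sign := option bool.

(* pmap id X lists the nonzero entries of X, in order; its subsequences are the
   mask m (pmap id X), and in bool "opposite signs" means "distinct". *)
Definition alt (n : nat) (X : n.-tuple sign) : nat :=
  \max_(m : (size (pmap id X)).-tuple bool
          | sorted (fun a b : bool => a != b) (mask m (pmap id X)))
     size (mask m (pmap id X)).

(* A linear ordering sigma of V is encoded as a duplicate-free tuple of length
   #|V|, whose entry tnth sigma j is sigma(j); sign_part true sigma X and
   sign_part false sigma X are X^+_sigma and X^-_sigma. *)
Definition sign_part (V : finType) (b : bool) (sigma : #|V|.-tuple V)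
    (X : #|V|.-tuple sign) : {set V} :=
  [set tnth sigma j | j : 'I_#|V| & tnth X j == Some b].

Definition contains_edge (H : hypergraph) (A : {set hvertex H}) : bool :=
  [exists e in hedges H, e \subset A].

Definition salt_ord (H : hypergraph)
    (sigma : #|{: hvertex H}|.-tuple (hvertex H)) : nat :=
  \max_(X : #|{: hvertex H}|.-tuple sign
          | ~~ (contains_edge (sign_part true sigma X)
                && contains_edge (sign_part false sigma X)))
     alt X.

(* The default value of the minimum is harmless: there is always an ordering,
   and salt_ord is at most the number of vertices (salt_ord_le). *)
Definition salt (H : hypergraph) : nat :=
  \big[minn/#|{: hvertex H}|]_(sigma : #|{: hvertex H}|.-tuple (hvertex H)
                                | uniq sigma) salt_ord sigma.

Lemma alt_le (n : nat) (X : n.-tuple sign) : alt X <= n.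
Proof.
apply/bigmax_leqP => m _; rewrite size_mask ?size_tuple //.
apply: leq_trans (count_size _ _) _; rewrite size_tuple size_pmap.
by rewrite -[leqRHS](size_tuple X) count_size.
Qed.

Lemma salt_ord_le (H : hypergraph)
    (sigma : #|{: hvertex H}|.-tuple (hvertex H)) :
  salt_ord sigma <= #|{: hvertex H}|.
Proof. by apply/bigmax_leqP => X _; exact: alt_le. Qed.

(* The truncated subtraction is exact, since salt H <= #|hvertex H|. *)
Definition altermatic_bound (H : hypergraph) : nat :=
  #|{: hvertex H}| + 1 - salt H.

(* The strong altermatic number of G is m: m is attained and is an upper
   bound. This is a relation because the maximum is over infinitely many
   hypergraphs, and that it exists is a theorem. *)
Definition strong_altermatic_number (G : sgraph) (m : nat) : Prop :=
  (exists2 H : hypergraph, hom_equiv (kneser H) G & altermatic_bound H = m) /\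
  (forall H : hypergraph, hom_equiv (kneser H) G -> altermatic_bound H <= m).

Section Mycielskian.
Variable G : sgraph.

(* inl (inl x) is the original vertex u_x, inl (inr x) is its copy v_x and
   inr tt is w. *)
Definition myc_adj : rel (G + G + unit)%type := fun a b =>
  match a, b with
  | inl (inl x), inl (inl y) => adj x y
  | inl (inl x), inl (inr y) => adj x y
  | inl (inr x), inl (inl y) => adj x y
  | inl (inr _), inr _ => true
  | inr _, inl (inr _) => true
  | _, _ => false
  end.

Lemma myc_sym : symmetric myc_adj.
Proof. by move=> [[x|x]|x] [[y|y]|y] //=; exact: adj_sym. Qed.

Lemma myc_irr : irreflexive myc_adj.
Proof. by move=> [[x|x]|x] //=; exact: adj_irr. Qed.

Definition mycielskian : sgraph := SGraph myc_sym myc_irr.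

End Mycielskian.

Section Product.
Variables G H : sgraph.

Definition prod_adj : rel (G * H)%type :=
  fun a b => adj a.1 b.1 && adj a.2 b.2.

Lemma prod_sym : symmetric prod_adj.
Proof.
by move=> a b; rewrite /prod_adj (adj_sym a.1) (adj_sym a.2).
Qed.

Lemma prod_irr : irreflexive prod_adj.
Proof. by move=> a; rewrite /prod_adj adj_irr. Qed.

Definition cat_prod : sgraph := SGraph prod_sym prod_irr.

End Product.

(* Main.v *)
Require Import Defs.
From mathcomp Require Import all_boot.

Set Implicit Arguments.
Unset Strict Implicit.
Unset Printing Implicit Defensive.

(* Let B(G) be the box complex of G with its free involution. Call its
   Z/2-homological coindex at least d when there are mod 2 chains c_0, ..., c_d
   with c_0 of odd augmentation and boundary(c_(i+1)) = c_i + tau c_i; this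
   replaces equivariant maps from the d-sphere.
   - An m-coloring signs the arcs of G, and evaluating the cocycle "signs
     alternate when the arcs are sorted by color" (Ky Fan's argument) on c_d gives
     an alternating simplex, so m >= d + 2.
   - The coindex of a product is the minimum, by the diagonal of the minimal
     resolution of Z/2 and the shuffle product: this gives Hedetniemi's equality
     whenever the coindex bound is tight for both factors.
   - M(G) raises the coindex by one, because the inclusion B(G) -> B(M(G)) is
     null-homotopic, so B(M(G)) receives the suspension of B(G).
   - The sphere of nonzero sign vectors of length n has the chains of S^(n-1);
     capping k times with the class w_1, represented by the first sign, moves
     them into { X : alt X > k } and lowers the dimension by k. For k = salt, each
     such X has an edge in X^+ and an edge in X^-, that is, an arc of KG(F). *)

Local Notation "\xor_ ( t <- l ) F" := (\big[addb/false]_(t <- l) F)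
  (at level 41, F at level 41, t, l at level 50).

Ltac xor_atom a :=
  lazymatch a with
  | addb ?b ?c => first [xor_atom b | xor_atom c]
  | negb ?b => xor_atom b
  | true => fail
  | false => fail
  | _ => case: a => /=
  end.

(** Proves identities of sums over F_2 by trying both values of every summand. *)
Ltac xor_cases :=
  rewrite /=;
  repeat match goal with
  | |- ?a = ?b => first [xor_atom a | xor_atom b]
  end; by [].

(** * Resolutions, suspension and cap product *)

Section Boundary.
Variable T : Type.

(** The empty tuple counts as the face of a vertex, so cochains are augmented: [cobd phi [:: x]] is
    [phi [::]]. *)
Fixpoint faces (s : seq T) : seq (seq T) :=
  if s is x :: s' then s' :: map (cons x) (faces s') else [::].

Definition cobd (phi : seq T -> bool) (s : seq T) : bool :=
  \xor_(t <- faces s) phi t.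

Lemma cobd_nil phi : cobd phi [::] = false.
Proof. by rewrite /cobd big_nil. Qed.

Lemma cobd_cons phi x s :
  cobd phi (x :: s) = phi s (+) cobd (fun t => phi (x :: t)) s.
Proof. by rewrite /cobd /= big_cons big_map. Qed.

Lemma eq_cobd phi psi s : phi =1 psi -> cobd phi s = cobd psi s.
Proof. by move=> e; apply: eq_bigr => t _; rewrite e. Qed.

Lemma cobd_add phi psi s :
  cobd (fun t => phi t (+) psi t) s = cobd phi s (+) cobd psi s.
Proof. by rewrite /cobd big_split. Qed.

End Boundary.

Lemma cobd_map (T U : Type) (f : T -> U) phi s :
  cobd phi (map f s) = cobd (fun t => phi (map f t)) s.
Proof.
elim: s phi => [|x s IHs] phi; first by rewrite !cobd_nil.
by rewrite /= !cobd_cons IHs.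
Qed.

Lemma cobd_subseq (T : eqType) (phi psi : seq T -> bool) s :
  (forall t, subseq t s -> phi t = psi t) -> cobd phi s = cobd psi s.
Proof.
elim: s phi psi => [|x s IHs] phi psi e; first by rewrite !cobd_nil.
rewrite !cobd_cons e ?subseq_cons //; congr (_ (+) _).
by apply: IHs => t ts; apply: e; rewrite /= eqxx.
Qed.

(** The entry [x] is compared with itself too: [R x x] says that [x] is a vertex of the complex. *)
Fixpoint simp (T : Type) (R : rel T) (s : seq T) : bool :=
  if s is x :: s' then all (R x) s && simp R s' else true.

(* A cochain is a boolean function on tuples; an i-chain over F_2 is encoded as
   an additive functional on cochains that only sees the tuples with i+1 entries
   related by R. A resolution of length D is then a family of chains
   c_0, ..., c_(D-1) with boundary(c_(i+1)) = c_i + tau c_i and c_0 of odd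
   augmentation, that is, an equivariant chain map out of the
   (D-1)-skeleton of the minimal resolution of Z/2. *)
Definition resolves (T : Type) (tau : T -> T) (R : rel T) (D : nat)
    (c : nat -> (seq T -> bool) -> bool) : Prop :=
  [/\ forall i phi psi,
        c i (fun s => phi s (+) psi s) = c i phi (+) c i psi,
      forall i phi psi,
        (forall s, size s = i.+1 -> simp R s -> phi s = psi s) ->
        c i phi = c i psi,
      forall i phi, i.+1 < D ->
        c i.+1 (cobd phi) = c i phi (+) c i (fun s => phi (map tau s)) &
      0 < D -> c 0 (fun=> true) = true].

Definition resolution (T : Type) (tau : T -> T) (R : rel T) (D : nat) : Prop :=
  exists c, resolves tau R D c.

Lemma resolution_leq (T : Type) (tau : T -> T) (R : rel T) D D' :
  D' <= D -> resolution tau R D -> resolution tau R D'.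
Proof.
move=> le [c [ca cl cb cu]]; exists c; split=> //.
- by move=> i phi lti; apply: cb; apply: leq_trans lti le.
- by move=> lt0; apply: cu; apply: leq_trans lt0 le.
Qed.

Section Functional.
Variables (T : Type) (tau : T -> T) (R : rel T) (D : nat).
Variable c : nat -> (seq T -> bool) -> bool.
Hypothesis cR : resolves tau R D c.

Lemma resolves_add i phi psi :
  c i (fun s => phi s (+) psi s) = c i phi (+) c i psi.
Proof. by case: cR. Qed.

Lemma resolves_local i phi psi :
  (forall s, size s = i.+1 -> simp R s -> phi s = psi s) -> c i phi = c i psi.
Proof. by case: cR => _ + _ _; apply. Qed.

Lemma resolves_ext i phi psi : phi =1 psi -> c i phi = c i psi.
Proof. by move=> e; apply: resolves_local. Qed.

Lemma resolves_false i : c i (fun=> false) = false.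
Proof.
have := resolves_add i (fun=> false) (fun=> false).
by rewrite (@resolves_ext _ _ (fun=> false)) //; case: (c i _).
Qed.

Lemma resolves_const b : 0 < D -> c 0 (fun=> b) = b.
Proof. by case: b => [|_]; [case: cR | apply: resolves_false]. Qed.

Lemma resolves_xor (I : Type) (r : seq I) (F : I -> seq T -> bool) i :
  c i (fun s => \xor_(k <- r) F k s) = \xor_(k <- r) c i (F k).
Proof.
elim: r => [|k r IHr].
  rewrite big_nil -[RHS](resolves_false i); apply: resolves_ext => s.
  by rewrite big_nil.
rewrite big_cons -IHr -resolves_add; apply: resolves_ext => s.
by rewrite big_cons.
Qed.

End Functional.

Lemma simp_map (T U : Type) (R : rel T) (S : rel U) (f : T -> U) s :
  (forall x y, R x y -> S (f x) (f y)) -> simp R s -> simp S (map f s).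
Proof.
move=> RS; elim: s => //= x s IHs /andP[/andP[xx xs] /IHs ->].
rewrite RS //= andbT all_map; apply: sub_all xs => y; exact: RS.
Qed.

(** Chains are pushed forward by pulling cochains back along [f]. Equivariance on vertices suffices
    because [c i] sees only simplices. *)
Lemma resolution_map (T U : eqType) (tau : T -> T) (sigma : U -> U)
    (R : rel T) (S : rel U) (f : T -> U) D :
  (forall x y, R x y -> S (f x) (f y)) ->
  (forall x, R x x -> f (tau x) = sigma (f x)) ->
  resolution tau R D -> resolution sigma S D.
Proof.
move=> RS ft [c cR]; case: (cR) => ca cl cb cu.
exists (fun i phi => c i (fun s => phi (map f s))); split=> //.
- move=> i phi psi e; apply: cl => s sz /(simp_map RS) sS.
  by apply: e; rewrite ?size_map.
- move=> i phi lti.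
  rewrite -(cl _ _ _ (fun s _ _ => esym (cobd_map f phi s))) cb //.
  congr (_ (+) _); apply: cl => s _ sR; congr phi.
  elim: s sR => //= x s IHs /andP[/andP[xx _] /IHs ->].
  by rewrite ft.
Qed.

Section Suspension.

(** The tuples [f x_0, ..., f x_i, g x_i, ..., g x_n], which triangulate a homotopy from [f] to
    [g]. *)
Fixpoint prism (T U : Type) (f g : T -> U) (s : seq T) : seq (seq U) :=
  if s is x :: s' then
    (f x :: map g s) :: map (cons (f x)) (prism f g s')
  else [::].

Lemma cobd_prism (T U : Type) (f g : T -> U) phi s :
  \xor_(t <- prism f g s) cobd phi t =
    phi (map f s) (+) phi (map g s)
      (+) cobd (fun s' => \xor_(t <- prism f g s') phi t) s.
Proof.
elim: s phi => [|x s IHs] phi; first by rewrite big_nil cobd_nil addbF addbb.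
rewrite /= big_cons big_map !cobd_cons.
under eq_bigr => t _ do rewrite cobd_cons.
rewrite big_split /= IHs.
under [in RHS]eq_cobd => t do rewrite big_cons big_map.
rewrite cobd_add cobd_map /=.
by xor_cases.
Qed.

Lemma prism_simp (T U : eqType) (R : rel T) (S : rel U) (f g : T -> U) s t :
  (forall x y, R x y -> S (f x) (f y)) ->
  (forall x y, R x y -> S (f x) (g y)) ->
  (forall x y, R x y -> S (g x) (g y)) ->
  simp R s -> t \in prism f g s ->
  [/\ size t = (size s).+1, simp S t &
      forall u, all (fun x => S u (f x) && S u (g x)) s -> all (S u) t].
Proof.
move=> ff fg gg; elim: s t => //= x s IHs t /andP[/andP[xx xs] sS].
rewrite inE => /predU1P[-> | /mapP[t' /IHs[//|sz st at'] ->]].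
  split; rewrite /= ?size_map //.
    rewrite ff // fg // gg //= (simp_map gg sS) andbT !all_map.
    apply/andP; split; apply: sub_all xs => y Rxy /=; [exact: fg | exact: gg].
  move=> u /andP[/andP[-> ->]] /= us; rewrite all_map.
  by apply: sub_all us => y /andP[].
split; rewrite /= ?sz //.
  rewrite ff //= st at' //.
  by apply: sub_all xs => y Rxy; rewrite ff // fg.
by move=> u /andP[/andP[-> _]] /at' ->.
Qed.

Variables (T U : eqType) (tau : T -> T) (sigma : U -> U).
Variables (R : rel T) (S : rel U) (f0 f1 f2 : T -> U) (p : U) (D : nat).
Hypothesis tauK : involutive tau.
Hypothesis sigmaK : involutive sigma.
Hypothesis tauR : forall x y, R x y -> R (tau x) (tau y).
Hypothesis sigmaS : forall x y, S x y -> S (sigma x) (sigma y).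
Hypothesis f0_tau : forall x, f0 (tau x) = sigma (f0 x).
Hypothesis f00 : forall x y, R x y -> S (f0 x) (f0 y).
Hypothesis f01 : forall x y, R x y -> S (f0 x) (f1 y).
Hypothesis f11 : forall x y, R x y -> S (f1 x) (f1 y).
Hypothesis f12 : forall x y, R x y -> S (f1 x) (f2 y).
Hypothesis f22 : forall x y, R x y -> S (f2 x) (f2 y).
Hypothesis pp : S p p.
Hypothesis pf2 : forall x, R x x -> S p (f2 x).

(** A null-homotopy of [f0]: it moves through [f1] to [f2], whose image is coned off from [p]. *)
Definition cyl (s : seq T) : seq (seq U) :=
  prism f0 f1 s ++ prism f1 f2 s ++ [:: p :: map f2 s].

Lemma cobd_cyl phi s :
  \xor_(t <- cyl s) cobd phi t =
    phi (map f0 s) (+) cobd (fun s' => \xor_(t <- cyl s') phi t) s.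
Proof.
rewrite !big_cat big_seq1 /= !cobd_prism cobd_cons cobd_map.
under [in RHS]eq_cobd => t do rewrite !big_cat big_seq1 /=.
rewrite !cobd_add.
by xor_cases.
Qed.

Lemma simp_cyl s t : simp R s -> t \in cyl s ->
  size t = (size s).+1 /\ simp S t.
Proof.
move=> sR; rewrite !mem_cat => /or3P[|/(prism_simp f11 f12 f22 sR)[]|] //.
  by case/(prism_simp f00 f01 f11 sR).
rewrite inE => /eqP ->; rewrite /= size_map pp (simp_map f22 sR) andbT.
split=> //; rewrite all_map; elim: s sR => //= x s IHs.
by case/andP=> /andP[/pf2 -> _] /IHs.
Qed.

(** One hemisphere is [cyl], the other its conjugate under [tau] and [sigma]. Their common boundary
    cancels mod 2 because [f0] is equivariant. The new bottom chain is [p]. *)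
Lemma resolution_suspension : resolution tau R D -> resolution sigma S D.+1.
Proof.
move=> [c cR]; case: (cR) => ca cl cb cu.
have xorD := resolves_add cR.
have ext := resolves_ext cR.
pose h phi s := \xor_(t <- cyl s) phi t.
pose e phi s := h phi s (+) h (fun t => phi (map sigma t)) (map tau s).
have mapK (V : Type) (g : V -> V) : involutive g -> involutive (map g).
  by move=> gK s; rewrite -map_comp (eq_map (g := id)) ?map_id // => x /=; exact: gK.
have simp_tau s : simp R s -> simp R (map tau s) by apply: simp_map.
have simp_sigma s : simp S s -> simp S (map sigma s) by apply: simp_map.
exists (fun i phi => if i is j.+1 then c j (e phi) else phi [:: p]); split=> //.
- case=> [|i] phi psi //; rewrite -xorD; apply: ext => s.
  rewrite /e /h !big_split /=; by xor_cases.
- case=> [|i] phi psi epp; first by rewrite epp //= pp.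
  apply: cl => s sz sR; rewrite /e /h; congr (_ (+) _); apply: eq_big_seq => t.
    by move/(simp_cyl sR) => [szt st]; rewrite epp // szt sz.
  move/(simp_cyl (simp_tau _ sR)) => [szt st].
  by rewrite epp ?size_map ?szt ?size_map ?sz // simp_sigma.
- move=> i phi lti.
  have -> : c i (e (cobd phi)) =
      c i (cobd (h phi)) (+) c i (cobd (fun s => h (fun t => phi (map sigma t)) (map tau s))).
    rewrite -xorD; apply: ext => s; rewrite /e /h cobd_cyl.
    under [X in _ (+) X]eq_bigr => t _ do rewrite cobd_map.
    rewrite cobd_cyl -(cobd_map tau (fun s => h (fun t => phi (map sigma t)) s)).
    have -> : map sigma (map f0 (map tau s)) = map f0 s.
      by rewrite -!map_comp; apply: eq_map => x /=; rewrite f0_tau sigmaK.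
    by rewrite /h; xor_cases.
  (* In the lowest degree the boundary of [c 0] is its augmentation, and [cyl [::]] is [p] alone. *)
  case: i lti => [|i] lti.
    have c0 psi : c 0 (cobd psi) = psi [::].
      rewrite -[RHS](resolves_const cR) //; apply: cl => -[|x []] //= _ _.
      by rewrite cobd_cons cobd_nil addbF.
    by rewrite !c0 /h /= !big_cat /= !big_nil !big_seq1.
  rewrite !cb // -!xorD; apply: ext => s; rewrite /e.
  have -> : h (fun t => phi (map sigma (map sigma t))) (map tau s) = h phi (map tau s).
    by apply: eq_bigr => t _; rewrite (mapK _ sigma).
  by rewrite (mapK _ tau) //; xor_cases.
Qed.

End Suspension.

Section Cap.
Variables (T : eqType) (tau : T -> T) (R : rel T) (eps A : pred T) (D : nat).
Hypothesis eps_tau : forall x, R x x -> eps (tau x) = ~~ eps x.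
Hypothesis A_step : forall x y, R x y -> R y y -> eps x != eps y -> A y.
Hypothesis A_up : forall x y, R x y -> A x -> A y.

(* Cap product with the first Stiefel-Whitney class, represented by the
   cocycle (x, y) |-> [eps x <> eps y]. *)
Lemma resolution_cap :
  resolution tau R D.+1 -> resolution tau (fun x y => A x && R x y) D.
Proof.
move=> [c cR]; case: (cR) => ca cl cb cu.
pose cap (phi : seq T -> bool) s :=
  if s is x :: (y :: _) as s' then (eps x (+) eps y) && phi s' else false.
exists (fun i phi => c i.+1 (cap phi)); split.
- move=> i phi psi; rewrite -ca; apply: (resolves_ext cR) => -[|x [|y s]] //=.
  by rewrite andb_addr.
- move=> i phi psi e; apply: cl => -[|x [|y s]] //= [sz].
  move=> /and3P[/and3P[xx xy xs] /andP[yy ys] sS].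
  (* Only simplices whose first step changes [eps] count; on these [A] holds from the second entry
     on. *)
  case: (boolP (eps x (+) eps y)) => //= /addbP exy.
  have Ay: A y by apply: (A_step xy) => //; rewrite -exy; case: (eps x).
  apply: e; rewrite /= ?sz // Ay yy /=.
  have sA : all A s by apply: sub_all ys => z yz; apply: A_up Ay.
  apply/andP; split; first exact: ys.
  elim: s sS sA {ys sz xs} => //= z s IHs /andP[zs sS] /andP[Az sA].
  rewrite Az IHs // andbT; move: zs => /andP[-> zs] /=; exact: zs.
- move=> i phi lti.
  (* The values of the cocycle on the three sides of [x, y, z] add up to zero. *)
  have -> : c i.+2 (cap (cobd phi)) = c i.+2 (cobd (cap phi)).
    apply: cl => -[|x [|y [|z s]]] //= _ _; rewrite !cobd_cons /=.
    have -> : cobd (fun t => (eps x (+) eps y) && phi [:: y, z & t]) s =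
              (eps x (+) eps y) && cobd (fun t => phi [:: y, z & t]) s.
      by rewrite /cobd big_distrr.
    by case: (eps x); case: (eps y); case: (eps z); rewrite /=; xor_cases.
  rewrite cb //; congr (_ (+) _); apply: cl => -[|x [|y s]] //= _.
  move=> /and3P[/and3P[xx _ _] /andP[yy _] _].
  by rewrite !eps_tau //; case: (eps x); case: (eps y).
- move=> lt0; rewrite -[RHS]cu // .
  (* On edges the cocycle is the coboundary of [eps], and [eps x (+) eps (tau x)] is true on
     vertices. *)
  have -> : c 1 (cap xpredT) = c 1 (cobd (fun s => if s is x :: _ then eps x else false)).
    apply: cl => -[|x [|y []]] //= _ _; rewrite !cobd_cons cobd_nil /=.
    by case: (eps x); case: (eps y).
  rewrite cb // -ca; apply: cl => -[|x []] //= _ /andP[/andP[xx _] _].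
  by rewrite eps_tau //; case: (eps x).
Qed.

End Cap.

(** * Products *)

Section Shuffle.
Variables T U : Type.

(** The staircase paths from the first to the last pair of entries, one coordinate moving at a time:
    the Eilenberg-Zilber triangulation of a product of simplices. *)
Fixpoint shuffles (s : seq T) : seq U -> seq (seq (T * U)) :=
  fix shuffles_s (t : seq U) : seq (seq (T * U)) :=
    match s, t with
    | x :: s', y :: t' =>
      if nilp s' && nilp t' then [:: [:: (x, y)]]
      else map (cons (x, y)) (shuffles s' t ++ shuffles_s t')
    | _, _ => [::]
    end.

Lemma shuffles_cons x s y t :
  shuffles (x :: s) (y :: t) =
    if nilp s && nilp t then [:: [:: (x, y)]]
    else map (cons (x, y)) (shuffles s (y :: t) ++ shuffles (x :: s) t).
Proof. by []. Qed.

Lemma shuffles0s t : shuffles [::] t = [::]. Proof. by case: t. Qed.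
Lemma shuffless0 s : shuffles s [::] = [::]. Proof. by case: s. Qed.

Definition cross (phi : seq (T * U) -> bool) s t : bool :=
  \xor_(u <- shuffles s t) phi u.

Lemma cross0s phi t : cross phi [::] t = false.
Proof. by rewrite /cross shuffles0s big_nil. Qed.

Lemma crosss0 phi s : cross phi s [::] = false.
Proof. by rewrite /cross shuffless0 big_nil. Qed.

Lemma cross_cons phi x s y t :
  cross phi (x :: s) (y :: t) =
    cross (fun u => phi ((x, y) :: u)) s (y :: t)
      (+) cross (fun u => phi ((x, y) :: u)) (x :: s) t
      (+) [&& nilp s, nilp t & phi [:: (x, y)]].
Proof.
rewrite {1}/cross shuffles_cons; case: s t => [|x' s] [|y' t];
  rewrite ?big_map ?big_cat ?addbF //.
by rewrite cross0s crosss0 big_seq1.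
Qed.

Lemma cross_add phi psi s t :
  cross (fun u => phi u (+) psi u) s t = cross phi s t (+) cross psi s t.
Proof. by rewrite /cross big_split. Qed.

Lemma eq_cross phi psi s t : phi =1 psi -> cross phi s t = cross psi s t.
Proof. by move=> e; apply: eq_bigr => u _; rewrite e. Qed.

Lemma cobd_nilp (V : Type) (b : bool) (s : seq V) :
  cobd (fun t => nilp t && b) s = (size s == 1) && b.
Proof.
case: s => [|x [|y s]]; rewrite ?cobd_nil ?cobd_cons ?cobd_nil ?addbF //=.
by rewrite /cobd big1.
Qed.

(* The Leibniz rule fails for the product of two vertices, because [faces]
   includes the empty face of a vertex. *)
Lemma cobd_cross phi s t :
  cross (cobd phi) s t =
    cobd (fun s' => cross phi s' t) s (+) cobd (fun t' => cross phi s t') t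
      (+) [&& size s == 1, size t == 1 & phi [::]].
Proof.
have zero (V : Type) (psi : seq V -> bool) r : psi =1 xpred0 -> cobd psi r = false.
  by move=> e; rewrite (eq_cobd _ e) /cobd big1.
elim: s t phi => [|x s IHs] t phi.
  by rewrite cross0s cobd_nil zero // => r; rewrite cross0s.
elim: t phi => [|y t IHt] phi.
  by rewrite crosss0 cobd_nil zero ?andbF // => r; rewrite crosss0.
rewrite cross_cons !(cobd_cons (fun _ => cross _ _ _)) /=.
set psi := fun u => phi ((x, y) :: u).
have cobdE u : cobd phi ((x, y) :: u) = phi u (+) cobd psi u by rewrite cobd_cons.
rewrite !(eq_cross _ _ cobdE) !cross_add IHs IHt cobdE cobd_nil addbF.
rewrite !(cobd_cons (fun _ => cross _ _ _)).
have -> : cobd (fun s' => cross phi (x :: s') (y :: t)) s =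
    cobd (fun s' => cross psi s' (y :: t)) s (+) cobd (fun s' => cross psi (x :: s') t) s
     (+) [&& size s == 1, nilp t & psi [::]].
  by rewrite -cobd_nilp -!cobd_add; apply: eq_cobd => s'; rewrite cross_cons.
have -> : cobd (fun t' => cross phi (x :: s) (y :: t')) t =
    cobd (fun t' => cross psi s (y :: t')) t (+) cobd (fun t' => cross psi (x :: s) t') t
     (+) [&& size t == 1, nilp s & psi [::]].
  rewrite -cobd_nilp -!cobd_add; apply: eq_cobd => t'; rewrite cross_cons.
  by congr (_ (+) _); rewrite andbCA.
rewrite !eqSS /nilp.
by case: (size s == 1) (size s == 0) (size t == 1) (size t == 0) => [] [] [] []; xor_cases.
Qed.

End Shuffle.

Lemma cross_map (T U : Type) (f : T -> T) (g : U -> U) phi s t :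
  cross phi (map f s) (map g t) =
  cross (fun u => phi (map (fun z => (f z.1, g z.2)) u)) s t.
Proof.
elim: s t phi => [|x s IHs] t phi; first by rewrite !cross0s.
elim: t phi => [|y t IHt] phi; first by rewrite !crosss0.
rewrite /= !cross_cons (IHs (y :: t)) IHt.
by rewrite /nilp !size_map.
Qed.

(** The middle conclusion lets the induction compare the first pair with all later ones. *)
Lemma shuffles_simp (T U : eqType) (R : rel T) (S : rel U) s t u :
  simp R s -> simp S t -> u \in shuffles s t ->
  [/\ size u = (size s + size t).-1, all (fun z => (z.1 \in s) && (z.2 \in t)) u
     & simp (fun z z' => R z.1 z'.1 && S z.2 z'.2) u].
Proof.
elim: s t u => [|x s IHs] t u; first by rewrite shuffles0s.
elim: t u => [|y t IHt] u //.
move=> /andP[xs sS] /andP[yt tT].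
have xx : R x x by case/andP: xs.
have yy : S y y by case/andP: yt.
rewrite shuffles_cons; case: ifP => [/andP[/nilP -> /nilP ->]|nn].
  by rewrite inE => /eqP ->; split; rewrite /= ?inE ?eqxx ?xx ?yy.
case/mapP => u' u'in ->.
have [sz al si] : [/\ size u' = (size s + size t),
    all (fun z => (z.1 \in x :: s) && (z.2 \in y :: t)) u'
     & simp (fun z z' => R z.1 z'.1 && S z.2 z'.2) u'].
  move: u'in; rewrite mem_cat => /orP[/IHs[||-> al si]|/IHt[||-> al si]] //.
  - by apply/andP; split.
  - split=> //; first by rewrite /= addnS.
    by apply: sub_all al => z /andP[z1 ->]; rewrite inE z1 orbT.
  - by apply/andP; split.
  - split=> //; apply: sub_all al => z /andP[-> z1]; by rewrite inE z1 orbT.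
split; first by rewrite /= sz addnS.
  by rewrite /= !inE !eqxx; exact: al.
rewrite /= xx yy si andbT; apply: sub_all al => z /andP[z1 z2].
by rewrite (allP xs) ?(allP yt).
Qed.

Lemma resolution_prod (T U : eqType) (tau : T -> T) (sigma : U -> U)
    (R : rel T) (S : rel U) D :
  (forall x y, R x y -> R (tau x) (tau y)) ->
  (forall x y, S x y -> S (sigma x) (sigma y)) ->
  resolution tau R D -> resolution sigma S D ->
  resolution (fun z => (tau z.1, sigma z.2))
    (fun z z' => R z.1 z'.1 && S z.2 z'.2) D.
Proof.
move=> tauR sigmaS [c cR] [d dS]; case: (cR) (dS) => ca cl cb cu [da dl db du].
have cext := resolves_ext cR; have dext := resolves_ext dS.
pose it j t := iter j (map sigma) t.
have it_simp j t : simp S t -> simp S (it j t).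
  by move=> tS; elim: j => //= j; apply: simp_map.
have size_it j t : size (it j t) = size t.
  by elim: j => //= j; rewrite size_map.
(* The diagonal e_i |-> \sum_j e_j (x) sigma^j e_(i-j) of the minimal resolution. *)
pose e i phi := \big[addb/false]_(j < i.+1)
  c j (fun s => d (i - j) (fun t => cross phi s (it j t))).
exists e; split.
- move=> i phi psi; rewrite /e -big_split /=; apply: eq_bigr => j _.
  rewrite -ca; apply: cext => s; rewrite -da; apply: dext => t.
  exact: cross_add.
- move=> i phi psi epp; rewrite /e; apply: eq_bigr => j _.
  apply: cl => s szs sR; apply: dl => t szt tS.
  apply: eq_big_seq => u /(shuffles_simp sR (it_simp j _ tS)) [szu _ su].
  apply: epp => //; rewrite szu size_it szs szt addSn addnS /=.
  by rewrite subnKC // -ltnS.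
- move=> i phi lti; rewrite /e.
  have split_cobd (j : 'I_i.+2) : c j (fun s => d (i.+1 - j) (fun t => cross (cobd phi) s (it j t))) =
     c j (cobd (fun s => d (i.+1 - j) (fun t => cross phi s (it j t)))) (+)
     c j (fun s => d (i.+1 - j) (cobd (fun t => cross phi s (it j t)))).
    rewrite -ca; apply: cl => s szs _.
    rewrite /cobd -(resolves_xor dS) -da; apply: dl => t szt _.
    rewrite cobd_cross size_it szs szt -/(cobd _ _).
    have -> : cobd (fun t' => cross phi s t') (it j t) =
              cobd (fun t' => cross phi s (it j t')) t.
      rewrite /it; elim: (nat_of_ord j) (cross phi s) => //= j' IHj psi.
      by rewrite cobd_map IHj.
    (* The correction term needs two vertices, but the degrees [j] and [i.+1 - j] are not both
       zero. *)
    rewrite andbA; have -> : (j.+1 == 1) && ((i.+1 - j).+1 == 1) = false.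
      by case: (j) => -[|m] //= ltj; rewrite subSS.
    by rewrite addbF.
  rewrite (eq_bigr _ (fun j _ => split_cobd j)) big_split /=.
  rewrite big_ord_recl [in X in _ (+) X]big_ord_recr /= subnn.
  have -> : c 0 (cobd (fun s => d (i.+1 - 0) (fun t => cross phi s (it 0 t)))) = false.
    rewrite -(resolves_false cR 0); apply: cl => -[|x []] //= _ _.
    rewrite cobd_cons cobd_nil addbF -(resolves_false dS i.+1).
    by apply: dext => t; rewrite cross0s.
  have -> : c i.+1 (fun s => d 0 (cobd (fun t => cross phi s (it i.+1 t)))) = false.
    rewrite -(resolves_false cR i.+1); apply: cl => s _ _.
    rewrite -(resolves_false dS 0); apply: dl => -[|y []] // _ _.
    rewrite cobd_cons cobd_nil addbF -(crosss0 phi s); congr cross.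
    by elim: (i) => //= j ->.
  (* For each j the two copies of e_j (x) sigma^(j+1) e_(i-j) cancel, leaving the j-th term of the
     diagonal and its image under the involution. *)
  rewrite /= addbF -!big_split /=; apply: eq_bigr => j _.
  rewrite /bump /= add1n subSS cb; last by apply: leq_ltn_trans lti; rewrite ltn_ord.
  have -> : c j (fun s => d (i.+1 - j) (cobd (fun t => cross phi s (it j t)))) =
      c j (fun s => d (i - j) (fun t => cross phi s (it j t))) (+)
      c j (fun s => d (i - j) (fun t => cross phi s (it j.+1 t))).
    rewrite -ca; apply: cext => s; rewrite subSn; last by rewrite -ltnS.
    rewrite db; last by apply: leq_ltn_trans lti; rewrite ltnS leq_subr.
    by congr (_ (+) _); apply: dext => t; rewrite /it -iterSr.
  have -> : c j (fun s => d (i - j) (fun t => cross (fun u => phi (map (fun z => (tau z.1, sigma z.2)) u)) s (it j t))) =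
     c j (fun s => d (i - j) (fun t => cross phi (map tau s) (it j.+1 t))).
    by apply: cext => s; apply: dext => t; rewrite /= cross_map.
  by xor_cases.
- move=> lt0; rewrite /e big_ord_recl big_ord0 addbF /=.
  rewrite -[RHS]cu //; apply: cl => -[|x []] // _ _.
  rewrite -[RHS]du //; apply: dl => -[|y []] // _ _.
  by rewrite /cross /= big_seq1.
Qed.

(** * Sign vectors *)

Lemma resolution0 (T : Type) (tau : T -> T) (R : rel T) : resolution tau R 0.
Proof. by exists (fun _ _ => false). Qed.

Section SignVectors.

Definition opp_sv (X : seq sign) : seq sign := map (omap negb) X.

Definition le_sv (X Y : seq sign) : bool :=
  all2 (fun a b : sign => (a == None) || (a == b)) X Y.

(** Nonzero sign vectors are the faces of the boundary of the cross-polytope, so the simplices form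
    its barycentric subdivision, an (n-1)-sphere. *)
Definition sphere_rel (n : nat) (X Y : seq sign) : bool :=
  [&& size X == n, has isSome X & le_sv X Y].

Lemma opp_svK : involutive opp_sv.
Proof. by elim=> //= -[[]|] X ->. Qed.

Lemma le_sv_refl X : le_sv X X.
Proof. by rewrite /le_sv; elim: X => //= a X ->; rewrite eqxx orbT. Qed.

Lemma le_sv_opp X Y : le_sv X Y -> le_sv (opp_sv X) (opp_sv Y).
Proof.
rewrite /le_sv; elim: X Y => [|a X IHX] [|b Y] //= /andP[ab /IHX ->].
by rewrite andbT; case: a b ab => [[]|] [[]|].
Qed.

Lemma has_opp_sv X : has isSome (opp_sv X) = has isSome X.
Proof. by rewrite /opp_sv has_map; apply: eq_has => -[]. Qed.

Lemma le_sv0 X : le_sv (nseq (size X) None) X.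
Proof. by rewrite /le_sv; elim: X. Qed.

Lemma sphere_rel_opp n X Y :
  sphere_rel n X Y -> sphere_rel n (opp_sv X) (opp_sv Y).
Proof.
by case/and3P=> sz hX XY; rewrite /sphere_rel size_map sz has_opp_sv hX le_sv_opp.
Qed.

(** Induction over the equator [None :: X]: making the new entry positive puts every vector above
    [p], so the equator is null-homotopic. *)
Lemma resolution_sphere n : resolution opp_sv (sphere_rel n) n.
Proof.
elim: n => [|n IHn]; first exact: resolution0.
apply: (resolution_suspension (f0 := cons None) (f1 := cons (Some true))
  (f2 := cons (Some true)) (p := Some true :: nseq n None) _ _ _ _ _ _ _ _ _ _ _ _ IHn).
- exact: opp_svK.
- exact: opp_svK.
- exact: sphere_rel_opp.
- exact: sphere_rel_opp.
- by [].
- by move=> X Y /and3P[sz hX XY]; rewrite /sphere_rel /= eqSS sz hX.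
- by move=> X Y /and3P[sz hX XY]; rewrite /sphere_rel /= eqSS sz hX.
- by move=> X Y /and3P[sz hX XY]; rewrite /sphere_rel /= eqSS sz.
- by move=> X Y /and3P[sz hX XY]; rewrite /sphere_rel /= eqSS sz.
- by move=> X Y /and3P[sz hX XY]; rewrite /sphere_rel /= eqSS sz.
- by rewrite /sphere_rel le_sv_refl /= size_nseq eqxx.
- by move=> X /and3P[/eqP <- _ _]; rewrite /sphere_rel /= size_nseq eqxx le_sv0.
Qed.

Definition altS (X : seq sign) : nat := alt (in_tuple X).

Lemma altS_tuple n (X : n.-tuple sign) : altS X = alt X.
Proof.
by case: X => X sz; have e := eqP sz; subst n; congr alt; apply: val_inj.
Qed.

Lemma leq_altP X k :
  reflect (exists m, [/\ subseq m (pmap id X), sorted (fun a b : bool => a != b) m & k <= size m])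
    (k <= altS X).
Proof.
apply: (iffP idP) => [|[m [/subseqP[u su ->] so le]]].
  move=> le.
  have [|u so e] := @eq_bigmax_cond _ [pred u : (size (pmap id (in_tuple X))).-tuple bool |
    sorted (fun a b : bool => a != b) (mask u (pmap id (in_tuple X)))]
    (fun u => size (mask u (pmap id (in_tuple X)))).
    apply/card_gt0P; exists (nseq_tuple _ false).
    by rewrite inE /= mask_false.
  exists (mask u (pmap id X)); split=> //; first exact: mask_subseq.
  by rewrite -e.
apply: leq_trans le _.
have sz : size u == size (pmap id (in_tuple X)) by rewrite su.
by apply: (@leq_bigmax_cond _ _ _ (Tuple sz)).
Qed.

Lemma pmap_le_sv X Y : le_sv X Y -> subseq (pmap id X) (pmap id Y).
Proof.
rewrite /le_sv; elim: X Y => [|a X IHX] [|b Y] //= /andP[ab /IHX XY].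
case: a b ab => [a|] [b|] //= ab.
  by case/eqP: ab => ->; rewrite eqxx.
by have := subseq_trans XY (subseq_cons _ b).
Qed.

Lemma altS_le X Y : le_sv X Y -> altS X <= altS Y.
Proof.
move=> /pmap_le_sv XY; apply/leq_altP.
have /leq_altP[m [mX so le]] := leqnn (altS X).
by exists m; split=> //; apply: (subseq_trans mX).
Qed.

Lemma has_pmap X : has isSome X -> exists b s, pmap id X = b :: s :> seq bool.
Proof. by elim: X => //= -[b|] X IHX //=; exists b, (pmap id X). Qed.

Lemma altS_gt0 X : has isSome X -> 0 < altS X.
Proof.
move=> /has_pmap[b [s e]]; apply/leq_altP; exists [:: b].
by rewrite e /= eqxx sub0seq.
Qed.

Definition first_sign (X : seq sign) : bool := head false (pmap id X).

Lemma first_sign_opp X : has isSome X -> first_sign (opp_sv X) = ~~ first_sign X.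
Proof. by rewrite /first_sign; elim: X => //= -[b|]. Qed.

(* An optimal alternating subsequence of X can be taken to start with the first
   sign of X, hence the other first sign of Y can be put before it. *)
Lemma altS_first_sign X Y : le_sv X Y -> has isSome X ->
  first_sign X != first_sign Y -> altS X < altS Y.
Proof.
move=> /pmap_le_sv XY /has_pmap[b [s eX]]; rewrite /first_sign.
have /leq_altP[m [mX so le]] := leqnn (altS X).
move: XY; rewrite eX /=; case eY: (pmap id Y) => [//|b' s'] XY /= bb'.
have [m' [mX' so' le' hm']] : exists m', [/\ subseq m' (b :: s),
    sorted (fun a b : bool => a != b) m', altS X <= size m' & head b m' = b].
  case: m mX so le => [|h m] mX so le.
    by exists [::].
  case: (eqVneq h b) => [hb|hb].
    by exists (h :: m); split=> //; rewrite -eX.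
  exists (b :: h :: m); split=> //=.
  - by rewrite eqxx; move: mX; rewrite eX /= (negbTE hb).
  - by rewrite eq_sym hb.
  - exact: leqW.
apply/leq_altP; exists (b' :: m'); split=> //=.
  (* Since [b'] differs from [b], the signs of X embed into [s'], behind [b']. *)
  rewrite eY /= eqxx; apply: (@subseq_trans _ s') => //.
  case: m' mX' {so' le'} hm' => [|h m'] /= mX' hm'; first exact: sub0seq.
  move: XY; rewrite /= (negbTE bb') => XY; rewrite hm'.
  by apply: (subseq_trans _ XY); move: mX'; rewrite hm' /= eqxx.
by case: m' so' hm' {mX' le'} => //= h m' -> ->; rewrite eq_sym bb'.
Qed.

(** Each cap with the cocycle of [first_sign] costs one dimension and, by [altS_first_sign], raises
    the least alternation number by one. *)
Lemma resolution_alt n k :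
  resolution opp_sv (fun X Y => (k < altS X) && sphere_rel n X Y) (n - k).
Proof.
elim: k => [|k IHk].
  rewrite subn0; apply: (resolution_map (f := id)) (resolution_sphere n) => //.
  by move=> X Y XY; rewrite XY andbT altS_gt0 //; case/and3P: XY.
case: (leqP n k) => [lenk|ltkn].
  by rewrite (eqP (leqW lenk : n - k.+1 == 0)); apply: resolution0.
have e : n - k = (n - k.+1).+1 by rewrite subnS prednK // subn_gt0.
rewrite e in IHk.
have := @resolution_cap _ opp_sv _ first_sign (fun X => k.+1 < altS X) _ _ _ _ IHk.
move=> cap; apply: (resolution_map (f := id)) (cap _ _ _) => //.
- by move=> X Y /and3P[-> _ ->].
- by move=> X /and4P[_ _ hX _]; rewrite first_sign_opp.
- move=> X Y /and4P[altX _ hX XY] _ ne.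
  by apply: leq_ltn_trans altX _; apply: altS_first_sign.
- by move=> X Y /and4P[_ _ _ XY] altX; apply: leq_trans altX (altS_le XY).
Qed.

End SignVectors.

(** * Arcs of graphs *)

Section Arcs.

Definition swap (T : Type) (x : T * T) : T * T := (x.2, x.1).

(* The box complex of G in arc form: its simplices are the sets of arcs (a_i, b_i) such that
   every a_i is adjacent to every b_j. *)
Definition arc_rel (G : sgraph) (x y : G * G) : bool :=
  adj x.1 y.2 && adj y.1 x.2.

Definition arc_resolution (G : sgraph) (D : nat) : Prop :=
  resolution (@swap G) (@arc_rel G) D.

Lemma arc_rel_swap (G : sgraph) (x y : G * G) :
  arc_rel x y -> arc_rel (swap x) (swap y).
Proof. by rewrite /arc_rel /= andbC !(adj_sym _.2). Qed.

Lemma arc_resolution_hom (G H : sgraph) D :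
  hom G H -> arc_resolution G D -> arc_resolution H D.
Proof.
case=> f fhom; apply: (resolution_map (f := fun x => (f x.1, f x.2))) => // x y.
by case/andP=> xy yx; rewrite /arc_rel !fhom.
Qed.

(** An arc of the product is a pair of arcs, and [arc_rel] holds componentwise. *)
Lemma arc_resolution_prod (G H : sgraph) D :
  arc_resolution G D -> arc_resolution H D -> arc_resolution (cat_prod G H) D.
Proof.
move=> GD HD.
have := resolution_prod (@arc_rel_swap G) (@arc_rel_swap H) GD HD.
apply: (resolution_map (T := ((G * G) * (H * H))%type)
  (U := (cat_prod G H * cat_prod G H)%type)
  (f := fun z => ((z.1.1, z.2.1), (z.1.2, z.2.2)))) => // x y.
rewrite /arc_rel /= /prod_adj /=.
by case/andP=> /andP[-> ->] /andP[-> ->].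
Qed.

(** The null-homotopy moves (u_a, u_b) to (u_a, v_b) and then to (w, v_b). All arcs leaving w are
    mutually related, so they contract to (w, v_x0). *)
Lemma arc_resolution_mycielskian (G : sgraph) (x0 : G) D :
  arc_resolution G D -> arc_resolution (mycielskian G) D.+1.
Proof.
pose M := mycielskian G.
pose u x : M := inl (inl x); pose v x : M := inl (inr x); pose w : M := inr tt.
have swapK (T : Type) : involutive (@swap T) by case.
apply: (resolution_suspension (T := (G * G)%type) (U := (M * M)%type)
  (f0 := fun x => (u x.1, u x.2)) (f1 := fun x => (u x.1, v x.2))
  (f2 := fun x => (w, v x.2)) (p := (w, v x0))) => //.
- exact: swapK.
- exact: swapK.
- exact: arc_rel_swap.
- exact: arc_rel_swap.
- by move=> x y /andP[xy yx]; rewrite /arc_rel /= andbT.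
Qed.

(** X goes to the arc formed by an edge chosen in X^+ and one chosen in X^-. For X below Y both
    parts grow, and Y^+ and Y^- are disjoint because [sigma] has no repetitions. *)
Lemma arc_resolution_kneser (F : hypergraph) (k0 : kneser F)
    (sigma : #|{: hvertex F}|.-tuple (hvertex F)) :
  uniq sigma -> arc_resolution (kneser F) (#|{: hvertex F}| - salt_ord sigma).
Proof.
move=> us; set n := #|_|; set k := salt_ord sigma.
pose part (b : bool) (X : seq sign) := [set tnth sigma j | j : 'I_n & nth None X j == Some b].
have partP (b : bool) (X : seq sign) v : reflect (exists2 j : 'I_n, nth None X j = Some b & v = tnth sigma j)
    (v \in part b X).
  apply: (iffP imsetP) => [[j]|[j ej ->]].
    by rewrite inE => /eqP ej ->; exists j.
  by exists j; rewrite ?inE ?ej.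
(* [k0] is a default for sets without an edge. The choice depends on the set only, which makes [f]
   below equivariant. *)
pose e (A : {set hvertex F}) : kneser F := odflt k0 [pick v : kneser F | val v \subset A].
have eP (A : {set hvertex F}) : contains_edge A -> val (e A) \subset A.
  rewrite /e => /existsP[a /andP[aF aA]]; case: pickP => //= /(_ (Sub a aF)).
  by rewrite SubK aA.
have part_opp b X : part b (opp_sv X) = part (~~ b) X.
  have nth_opp j : nth None (opp_sv X) j = omap negb (nth None X j).
    case: (ltnP j (size X)) => lt; first by rewrite (nth_map None).
    by rewrite !nth_default ?size_map.
  apply/setP => v; apply/idP/idP => /partP[j ej ->]; apply/partP; exists j => //;
    move: ej; rewrite nth_opp.
    by case: (nth _ _ _) => [c|] //= [<-]; rewrite negbK.
  by move=> ->; rewrite /= negbK.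
have part_edge (b : bool) X : k < altS X -> size X = n -> contains_edge (part b X).
  move=> ltk sz; have szT : size X == n by apply/eqP.
  have : contains_edge (part true X) && contains_edge (part false X).
    apply: contraLR ltk => ne; rewrite -leqNgt (altS_tuple (Tuple szT)).
    apply: (@leq_bigmax_cond _ _ _ (Tuple szT)).
    have partE c : part c X = sign_part c sigma (Tuple szT).
      apply/setP => v; apply/idP/idP.
        case/partP=> j ej ->; apply/imsetP; exists j => //.
        by rewrite inE (tnth_nth None) /= ej.
      case/imsetP=> j; rewrite inE (tnth_nth None) => /eqP ej ->.
      by apply/partP; exists j.
    by rewrite -!partE.
  by case/andP; case: b.
pose f (X : seq sign) := (e (part true X), e (part false X)).
apply: (resolution_map (f := f)) (resolution_alt n k) => [X Y|X _]; last first.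
  by rewrite /f /swap /= !part_opp.
case/and4P=> altX /eqP szX _ XY.
have szY : size Y = n by rewrite -szX; move: XY; rewrite /le_sv all2E => /andP[/eqP].
have altY : k < altS Y by apply: leq_trans altX (altS_le XY).
have XYj b j : nth None X j = Some b -> nth None Y j = Some b.
  move=> ej; have ltj : j < size X by rewrite ltnNge; apply/negP => le; rewrite nth_default in ej.
  move: XY; rewrite /le_sv all2E => /andP[/eqP eS /(all_nthP (None, None))/(_ j)].
  by rewrite size_zip -eS minnn => /(_ ltj); rewrite nth_zip //= ej => /eqP.
have part_sub b : part b X \subset part b Y.
  by apply/subsetP => v /partP[j /XYj ej ->]; apply/partP; exists j.
have part_disj : [disjoint part true Y & part false Y].
  apply/pred0P => v /=; apply/negP => /andP[/partP[i ei ->] /partP[j ej eij]].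
  by move: ei; rewrite (tuple_uniqP _ us _ _ eij) ej.
by apply/andP; split; rewrite /= /kneser_adj;
  apply: disjointW part_disj; apply: subset_trans (eP _ (part_edge _ _ _ _)) _.
Qed.

End Arcs.

(** * Colorings *)

Section Coloring.

Fixpoint alternates (b : bool) (s : seq bool) : bool :=
  if s is x :: s' then (x == b) && alternates (~~ b) s' else true.

(** If [s] alternates, exactly one deletion leaves a word alternating from [b]: that of the last
    entry or of the first. Otherwise none does, or the two deletions from a pair of equal neighbors
    do. *)
Lemma cobd_alternates b s :
  cobd (alternates b) s = alternates b s (+) alternates (~~ b) s.
Proof.
elim: s b => [|x s IHs] b; first by rewrite cobd_nil.
have cobd_and : cobd (fun t => alternates b (x :: t)) s =
    (x == b) && cobd (alternates (~~ b)) s by rewrite /cobd big_distrr.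
rewrite cobd_cons cobd_and IHs negbK /= {IHs cobd_and}.
by case: x; case: b => /=; xor_cases.
Qed.

(** For an invariant cochain the faces can be written [rem x r], which does not depend on the
    order. *)
Lemma cobd_perm (T : eqType) (phi : seq T -> bool) s t :
  (forall s' t', perm_eq s' t' -> phi s' = phi t') ->
  perm_eq s t -> cobd phi s = cobd phi t.
Proof.
have cobd_rem (psi : seq T -> bool) r :
    (forall s' t', perm_eq s' t' -> psi s' = psi t') ->
    cobd psi r = \xor_(x <- r) psi (rem x r).
  elim: r psi => [|x r IHr] psi inv; first by rewrite cobd_nil big_nil.
  rewrite cobd_cons big_cons /= eqxx IHr; last first.
    by move=> s' t' e; apply: inv; rewrite perm_cons.
  congr (_ (+) _); apply: eq_big_seq => y yr; apply: inv.
  by case: eqP => [->|_] //; rewrite perm_sym perm_to_rem.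
move=> inv st; rewrite !cobd_rem // (perm_big _ st); apply: eq_big_seq => x xt.
apply: inv; rewrite -(perm_cons x) -(permPl (perm_to_rem _)) ?(perm_mem st) //.
by rewrite -(permPr (perm_to_rem xt)).
Qed.

Lemma perm_sort_leq s t : perm_eq s t -> sort leq s = sort leq t.
Proof.
move=> st; apply/perm_sortP => //;
  [exact: leq_total | exact: leq_trans | exact: anti_leq].
Qed.

Lemma cobd_sort (phi : seq nat -> bool) s :
  cobd (fun t => phi (sort leq t)) s = cobd phi (sort leq s).
Proof.
rewrite (@cobd_perm _ _ s (sort leq s)); last 2 first.
- by move=> s' t' /perm_sort_leq ->.
- by rewrite perm_sym perm_sort.
apply: cobd_subseq => t ts; congr phi; apply: sorted_sort; first exact: leq_trans.
by apply: subseq_sorted ts (sort_sorted leq_total s); apply: leq_trans.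
Qed.

Definition flip (n : nat) : nat := ~~ odd n + n./2.*2.

(** Labels with distinct halves are ordered by their halves, which [flip] preserves. *)
Lemma sort_flip s : {in s &, injective half} ->
  sort leq (map flip s) = map flip (sort leq s).
Proof.
move=> inj; rewrite -(sorted_sort leq_trans (s := map flip (sort leq s))).
  by apply: perm_sort_leq; apply: perm_map; rewrite perm_sym perm_sort.
apply: (homo_sorted_in (P := [in s]) (e := leq)); last exact: sort_sorted leq_total s.
  move=> x y xs ys lexy; case: (eqVneq x y) => [-> //|nexy].
  have lt : x./2 < y./2.
    rewrite ltn_neqAle half_leq // andbT; apply: contraNneq nexy.
    by move/(inj _ _ xs ys)->.
  rewrite /flip; apply: (@leq_trans y./2.*2); last exact: leq_addl.
  apply: (@leq_trans (x./2.+1.*2)); last by rewrite leq_double.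
  by rewrite doubleS -addn2 addnC leq_add2l; case: (odd x).
by apply/allP => x; rewrite mem_sort.
Qed.

Lemma sorted_half b s : {in s &, injective half} -> sorted leq s ->
  alternates b (map odd s) -> sorted ltn (map half s).
Proof.
elim: s b => [|x [|y s] IHs] b //= inj /andP[xy ys] /and3P[/eqP ox /eqP oy al].
apply/andP; split; last first.
  apply: (IHs (~~ b)) => //=; last by rewrite oy eqxx.
  by move=> u v us vs; apply: inj; rewrite inE ?us ?vs orbT.
rewrite ltn_neqAle half_leq // andbT; apply/eqP => /inj e.
move: oy; rewrite -e ?inE ?eqxx ?orbT // ox; by case: b {ox al}.
Qed.

Variables (G : sgraph) (m : nat) (f : G -> 'I_m).
Hypothesis f_proper : forall x y : G, adj x y -> f x != f y.

(* Sorting labels sorts arcs by their larger color; the parity bit is the sign. *)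
Definition label (x : G * G) : nat :=
  (f x.1 < f x.2) + (maxn (f x.1) (f x.2)).*2.

Lemma odd_label x : odd (label x) = (f x.1 < f x.2).
Proof. by rewrite oddD odd_double addbF oddb. Qed.

Lemma half_label x : (label x)./2 = maxn (f x.1) (f x.2).
Proof. by rewrite /label half_bit_double. Qed.

Lemma label_swap x : arc_rel x x -> label (swap x) = flip (label x).
Proof.
case/andP=> /f_proper ne _; rewrite /flip odd_label half_label /label /= maxnC.
by rewrite -leqNgt [in RHS]leq_eqVlt eq_sym (negbTE (ne : f x.1 != f x.2 :> nat)).
Qed.

Lemma arc_rel_sym (x y : G * G) : arc_rel x y = arc_rel y x.
Proof. by rewrite /arc_rel andbC. Qed.

Lemma simp_arc_rel s (x y : G * G) :
  simp (@arc_rel G) s -> x \in s -> y \in s -> arc_rel x y.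
Proof.
elim: s => //= z s IHs /andP[/andP[zz zs] sS].
rewrite !inE => /predU1P[->|xs] /predU1P[->|ys] //.
- exact: (allP zs).
- by rewrite arc_rel_sym; apply: (allP zs).
- exact: IHs.
Qed.

Lemma label_inj s : simp (@arc_rel G) s -> {in map label s &, injective half}.
Proof.
move=> sS _ _ /mapP[x xs ->] /mapP[y ys ->].
have /andP[/f_proper ne1 /f_proper ne2] := simp_arc_rel sS xs ys.
rewrite !half_label => e; rewrite /label e; congr (nat_of_bool _ + _).
move: ne1 ne2 e; rewrite -!val_eqE /= => ne1 ne2.
by do 2![case: ltnP => _] => // e; move: ne1 ne2; rewrite e eqxx.
Qed.

Definition alternating_labels (b : bool) (s : seq (G * G)) : bool :=
  alternates b (map odd (sort leq (map label s))).

Lemma cobd_alternating_labels b s :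
  cobd (alternating_labels b) s =
    alternating_labels b s (+) alternating_labels (~~ b) s.
Proof.
rewrite -(cobd_map label (fun t => alternates b (map odd (sort leq t)))).
rewrite (cobd_sort (fun t => alternates b (map odd t))).
by rewrite -(cobd_map odd) cobd_alternates.
Qed.

Lemma alternating_labels_swap b s : simp (@arc_rel G) s ->
  alternating_labels b (map (@swap G) s) = alternating_labels (~~ b) s.
Proof.
move=> sS; rewrite /alternating_labels -map_comp.
have -> : map (label \o @swap G) s = map flip (map label s).
  rewrite -map_comp; apply/eq_in_map => x xs /=; apply: label_swap.
  exact: (simp_arc_rel sS).
rewrite sort_flip; last exact: label_inj.
elim: (sort _ _) b => //= n t IHt b; rewrite IHt; congr (_ && _).
by rewrite /flip oddD odd_double addbF oddb; case: (odd n); case: b.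
Qed.

(** The larger colors strictly increase and are never 0, so at most [m.-1] of them occur. *)
Lemma alternating_labels_size b s : 0 < m ->
  simp (@arc_rel G) s -> alternating_labels b s -> size s < m.
Proof.
move=> m_gt0 sS; have inj : {in sort leq (map label s) &, injective half}.
  by move=> x y; rewrite !mem_sort; apply: label_inj.
move=> /(sorted_half inj (sort_sorted leq_total _)) lt_sorted.
have /uniq_leq_size := sorted_uniq ltn_trans ltnn lt_sorted.
move=> /(_ (iota 1 m.-1)); rewrite size_map size_sort size_map size_iota.
rewrite -[m in _ < m](prednK m_gt0) ltnS; apply => h /mapP[n].
rewrite mem_sort => /mapP[x xs ->] ->; rewrite half_label mem_iota add1n prednK //.
have /andP[/f_proper + _] := simp_arc_rel sS xs xs.
rewrite -val_eqE neq_ltn leq_max gtn_max !ltn_ord andbT /=.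
by case/orP=> lt; rewrite (leq_ltn_trans _ lt) ?orbT.
Qed.

(** Ky Fan's parity argument: each chain has an odd number of alternating simplices, counting both
    starting signs. A vertex has exactly one sign; the step evaluates [cobd_alternating_labels] on
    the next chain. *)
Lemma resolves_alternating_labels D c i b :
  resolves (@swap G) (@arc_rel G) D c -> i < D ->
  c i (alternating_labels b) (+) c i (alternating_labels (~~ b)) = true.
Proof.
move=> cR; case: (cR) => ca cl cb cu; elim: i => [|i IHi] ltD.
  rewrite -ca -[RHS](cu ltD); apply: cl => -[|x []] // _ _.
  by rewrite /alternating_labels /=; case: (odd _); case: b.
rewrite -[RHS](IHi (ltnW ltD)) -ca.
rewrite -(resolves_ext cR _ (cobd_alternating_labels b)) cb //; congr (_ (+) _).
by apply: cl => s _ /alternating_labels_swap.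
Qed.

Lemma arc_resolution_coloring D : 0 < #|{: G}| -> arc_resolution G D -> D < m.
Proof.
case/card_gt0P=> x0 _; case: D => [_|D [c cR]]; first exact: leq_trans (ltn_ord (f x0)).
rewrite ltnNge; apply/negP => lemD.
have := resolves_alternating_labels true cR (ltnSn D).
(* With at most [D.+1] colors no simplex with [D.+1] entries alternates, against the odd parity. *)
have zero b : c D (alternating_labels b) = false.
  rewrite -(resolves_false cR D); apply: (resolves_local cR) => s sz sS.
  apply: contraTF lemD => /(alternating_labels_size (leq_ltn_trans _ (ltn_ord (f x0))) sS).
  by rewrite sz -ltnNge; apply.
by rewrite !zero.
Qed.

End Coloring.

(** * Chromatic numbers and tightness of the coindex bound *)

Lemma hom_colorable (G H : sgraph) m : hom G H -> colorable H m -> colorable G m.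
Proof.
case=> h hh /existsP[f /forallP fP]; apply/existsP; exists [ffun x => f (h x)].
apply/forallP => x; apply/forallP => y; apply/implyP => /hh hxy; rewrite !ffunE.
by have /forallP/(_ (h y))/implyP := fP (h x); apply.
Qed.

Lemma chromatic_number_colorable (G : sgraph) : colorable G (chromatic_number G).
Proof. by rewrite /chromatic_number; case: ex_minnP. Qed.

Lemma chromatic_number_le (G : sgraph) m : colorable G m -> chromatic_number G <= m.
Proof. by rewrite /chromatic_number; case: ex_minnP => k _; apply. Qed.

Lemma chromatic_number_hom (G H : sgraph) :
  hom G H -> chromatic_number G <= chromatic_number H.
Proof.
move=> GH; apply: chromatic_number_le; apply: hom_colorable GH _.
exact: chromatic_number_colorable.
Qed.

Lemma arc_resolution_chromatic_number (G : sgraph) D :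
  0 < #|{: G}| -> arc_resolution G D -> D < chromatic_number G.
Proof.
move=> G0 GD; have /existsP[f /forallP fP] := chromatic_number_colorable G.
apply: (arc_resolution_coloring (f := f)) GD => // x y xy.
by have /forallP/(_ y)/implyP := fP x; apply.
Qed.

Lemma chromatic_number_mycielskian (G : sgraph) :
  chromatic_number (mycielskian G) <= (chromatic_number G).+1.
Proof.
apply: chromatic_number_le.
have /existsP[f /forallP fP] := chromatic_number_colorable G.
pose c x := widen_ord (leqnSn _) (f x).
have c_proper x y : adj x y -> c x != c y.
  by move=> xy; have /forallP/(_ y)/implyP := fP x; apply.
have c_max x : c x != ord_max.
  by rewrite -val_eqE /= neq_ltn ltn_ord.
apply/existsP; exists [ffun a : mycielskian G =>
  match a with inl (inl x) => c x | inl (inr x) => c x | inr _ => ord_max end].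
apply/forallP => a; apply/forallP => b; apply/implyP; rewrite !ffunE.
case: a b => [[x|x]|[]] [[y|y]|[]] //=; try exact: c_proper.
by rewrite eq_sym.
Qed.

Lemma iter_mycielskian_gt0 (G : sgraph) k :
  0 < #|{: G}| -> 0 < #|{: iter k mycielskian G}|.
Proof.
by case: k => // k _; apply/card_gt0P; exists (inr tt : mycielskian _).
Qed.

Lemma chromatic_number_iter_mycielskian (G : sgraph) k :
  chromatic_number (iter k mycielskian G) <= chromatic_number G + k.
Proof.
elim: k => [|k IHk]; first by rewrite addn0.
by apply: leq_trans (chromatic_number_mycielskian _) _; rewrite addnS ltnS.
Qed.

Lemma arc_resolution_iter_mycielskian (G : sgraph) D k :
  0 < #|{: G}| -> arc_resolution G D ->
  arc_resolution (iter k mycielskian G) (D + k).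
Proof.
move=> G0 GD; elim: k => [|k IHk]; first by rewrite addn0.
have /card_gt0P[x0 _] := iter_mycielskian_gt0 k G0.
by rewrite addnS; apply: arc_resolution_mycielskian.
Qed.

Lemma salt_ord_salt (F : hypergraph) :
  exists2 sigma : #|{: hvertex F}|.-tuple (hvertex F),
    uniq sigma & salt_ord sigma <= salt F.
Proof.
rewrite /salt; elim/big_ind: _ => [|p q Hp Hq|sigma us].
(* The default value of the minimum is bounded below by any ordering. *)
- by exists (enum_tuple _); [apply: enum_uniq | apply: salt_ord_le].
- by rewrite /minn; case: ifP.
- by exists sigma.
Qed.

Lemma arc_resolution_altermatic_bound (F : hypergraph) (G : sgraph) :
  0 < #|{: G}| -> hom_equiv (kneser F) G ->
  arc_resolution G (altermatic_bound F).-1.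
Proof.
move=> /card_gt0P[x0 _] [FG [h _]].
have [sigma us le] := salt_ord_salt F.
apply: arc_resolution_hom FG _.
apply: resolution_leq (arc_resolution_kneser (h x0) us).
rewrite /altermatic_bound addn1 -subn1 subnAC subn1 /=.
exact: leq_sub2l.
Qed.

(** The bound is tight for [G]; each Mycielski step raises the length by one and the chromatic
    number by at most one, so it stays tight. *)
Lemma arc_resolution_iter_of_altermatic (G : sgraph) k :
  0 < #|{: G}| -> strong_altermatic_number G (chromatic_number G) ->
  arc_resolution (iter k mycielskian G)
    (chromatic_number (iter k mycielskian G)).-1.
Proof.
move=> G0 [[F FG eF] _].
have GD := arc_resolution_altermatic_bound G0 FG.
apply: resolution_leq (arc_resolution_iter_mycielskian k G0 GD).
rewrite eF; have := arc_resolution_chromatic_number G0 GD.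
have := chromatic_number_iter_mycielskian G k.
by case: (chromatic_number G) => // c le _; rewrite -subn1 leq_subLR.
Qed.

Theorem mainTheorem4 (G0 H0 : sgraph)
    (G0_gt0 : 0 < #|{: G0}|) (H0_gt0 : 0 < #|{: H0}|)
    (zetaG0 : strong_altermatic_number G0 (chromatic_number G0))
    (zetaH0 : strong_altermatic_number H0 (chromatic_number H0))
    (k l : nat) :
  let G := iter k mycielskian G0 in
  let H := iter l mycielskian H0 in
  chromatic_number (cat_prod G H)
    = minn (chromatic_number G) (chromatic_number H).
Proof.
move=> G H; apply/eqP; rewrite eqn_leq leq_min -!andbA; apply/and3P; split.
- by apply: chromatic_number_hom; exists fst => x y /andP[].
- by apply: chromatic_number_hom; exists snd => x y /andP[].
have GH0 : 0 < #|{: cat_prod G H}|.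
  by rewrite card_prod muln_gt0 !iter_mycielskian_gt0.
(* Both factors have resolutions of length [D], hence so does the product, and its chromatic number
   exceeds [D]. *)
set D := (minn (chromatic_number G) (chromatic_number H)).-1.
apply: leq_trans (leqSpred _) _; rewrite -/D.
apply: arc_resolution_chromatic_number => //; apply: arc_resolution_prod.
- apply: resolution_leq (arc_resolution_iter_of_altermatic k G0_gt0 zetaG0).
  by rewrite /D -!subn1 leq_sub2r ?geq_minl.
- apply: resolution_leq (arc_resolution_iter_of_altermatic l H0_gt0 zetaH0).
  by rewrite /D -!subn1 leq_sub2r ?geq_minr.
Qed.
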